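(* Let $\mathcal{W}$ be a sound, acyclic, free choice workflow net to which neither the merge rule nor the d-shortcut rule is applicable. Then $\mathcal{W}$ has exactly two clusters, namely $[i]$ and $[o]$.
   Context: A workflow net $(P,T,F,i,o)$ has the following components: - finite disjoint sets $P$ of places and $T$ of transitions; - arcs $F\subseteq(P\times T)\cup(T\times P)$; - a place $i$ without incoming arcs and a place $o$ without outgoing arcs; - the requirement that $(P\cup T,F\cup\{(o,i)\})$ is strongly connected. ${}^\bullet x$ and $x^\bullet$ denote input and output nodes. Markings and firing are standard. The initial (final) marking has exactly one token, on $i$ (on $o$). The net is sound if the final marking is reachable from every marking reachable from the initial marking, and every transition occurs in some firing sequence from the initial marking. It is free choice if for all places $p_1,p_2$, either $p_1^\bullet\cap p_2^\bullet=\emptyset$ or $p_1^\bullet=p_2^\bullet$. It is acyclic if $(P\cup T,F)$ is acyclic. The cluster $[x]$ of a node $x$ is the smallest set containing $x$, closed under $p\mapsto p^\bullet$ for places and $t\mapsto{}^\bullet t$ for transitions; clusters partition $P\cup T$. A cluster $c$ is free choice if $(p,t)\in F$ for all places $p\in c$ and transitions $t\in c$. The merge rule is applicable if there are distinct transitions $t_1,t_2$ with ${}^\bullet t_1={}^\bullet t_2$ and $t_1^\bullet=t_2^\bullet$. The d-shortcut rule is applicable if there are a transition $t$ and a free choice cluster $c\notin\{[o],[t]\}$ such that $c$ contains exactly one transition and all places of $c$ belong to $t^\bullet$. *)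

(* Defs.v *)
From mathcomp Require Import all_boot.
Set Implicit Arguments. Unset Strict Implicit. Unset Printing Implicit Defensive.

Section WorkflowNets.
(* A Petri net with places P, transitions T (disjoint finite types);
   arcs F are given by  pre p t  <-> (p,t) \in F  and  post t p <-> (t,p) \in F. *)
Variables (P T : finType) (pre : P -> T -> bool) (post : T -> P -> bool).

Definition node := (P + T)%type.

Definition flow : rel node := fun x y =>
  match x, y with
  | inl p, inr t => pre p t
  | inr t, inl p => post t p
  | _, _ => false
  end.

Definition flow_oi (i o : P) : rel node := fun x y =>
  flow x y || ((x == inl o) && (y == inl i)).

Definition is_workflow_net (i o : P) : Prop :=
  i != o /\
  (forall t, ~~ post t i) /\
  (forall t, ~~ pre o t) /\
  (forall x y : node, connect (flow_oi i o) x y).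

Definition preT (t : T) : {set P} := [set p | pre p t].
Definition postT (t : T) : {set P} := [set p | post t p].
Definition postP (p : P) : {set T} := [set t | pre p t].

Definition marking := {ffun P -> nat}.
Definition enabled (m : marking) (t : T) : bool := [forall p, pre p t ==> (0 < m p)].
Definition fire (m : marking) (t : T) : marking :=
  [ffun p => m p - pre p t + post t p].

Fixpoint fires (m : marking) (s : seq T) : option marking :=
  match s with
  | [::] => Some m
  | t :: s' => if enabled m t then fires (fire m t) s' else None
  end.

Definition reachable (m m' : marking) : Prop := exists s, fires m s = Some m'.

Definition mark1 (q : P) : marking := [ffun p => nat_of_bool (p == q)].

Definition sound (i o : P) : Prop :=
  (forall m, reachable (mark1 i) m -> reachable m (mark1 o)) /\
  (forall t : T, exists s m, fires (mark1 i) s = Some m /\ t \in s).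

Definition free_choice : Prop :=
  forall p1 p2 : P, postP p1 :&: postP p2 = set0 \/ postP p1 = postP p2.

Definition acyclic : Prop :=
  forall x y : node, flow x y -> ~~ connect flow y x.

Definition cluster_step : rel node := fun x y =>
  match x, y with
  | inl p, inr t => pre p t
  | inr t, inl p => pre p t
  | _, _ => false
  end.

Definition cluster (x : node) : {set node} := [set y | connect cluster_step x y].

Definition clusters : {set {set node}} := [set cluster x | x : node].

Definition cluster_places (c : {set node}) : {set P} := [set p | inl p \in c].
Definition cluster_transitions (c : {set node}) : {set T} := [set t | inr t \in c].

Definition free_choice_cluster (c : {set node}) : Prop :=
  forall p t, inl p \in c -> inr t \in c -> pre p t.

Definition merge_applicable : Prop :=
  exists t1 t2 : T, t1 != t2 /\ preT t1 = preT t2 /\ postT t1 = postT t2.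

Definition dshortcut_applicable (o : P) : Prop :=
  exists (t : T) (c : {set node}),
    c \in clusters /\ free_choice_cluster c /\
    c != cluster (inl o) /\ c != cluster (inr t) /\
    #|cluster_transitions c| = 1 /\
    cluster_places c \subset postT t.

End WorkflowNets.

(* Main.v *)
(** Call two transitions in conflict if they have the same preset, that is, if
    they lie in the same cluster; in an acyclic free choice net the clusters are
    partially ordered by causality.

    Suppose that there are conflicts, and let [t1], [t2] be in conflict in a
    cluster after which no further conflict occurs.  Take a reachable marking
    [m] that enables them and after which they are never enabled again.  After
    [t1] or [t2] fires at [m], only transitions causally after their cluster can
    fire, and these are conflict free.  Complete both firings to the final
    marking.  If the two completions have the same Parikh vector, the marking
    equation gives [t1^bullet = t2^bullet], and the merge rule applies.
    Otherwise let [u] be a causally first transition occurring a different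
    number of times, say more often after [t1]; each input place of [u] receives
    the same tokens in both runs except from [t1] and [t2], hence belongs to
    [t1^bullet], and the d-shortcut rule applies to [t1] and [[u]].

    Without conflicts, the input places of a causally first transition not in
    [[i]] are all filled by the unique transition of [[i]], and the d-shortcut
    rule applies again. *)
Require Import Defs.
From mathcomp Require Import all_boot.
From mathcomp Require Import zify.

Set Implicit Arguments.
Unset Strict Implicit.
Unset Printing Implicit Defensive.

(** * Reachability and counting in finite types *)

Lemma connect_neq_succ (V : finType) (e : rel V) x y :
  connect e x y -> x != y -> exists z, e x z.
Proof.
by case/connectP=> -[/= _ -> | z s /= /andP[exz _] _ _]; [rewrite eqxx | exists z].
Qed.

Lemma connect_neq_pred (V : finType) (e : rel V) x y :
  connect e x y -> x != y -> exists z, e z y.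
Proof.
case/connectP=> s; elim/last_ind: s => [|s z _] /=; first by move=> _ ->; rewrite eqxx.
by rewrite rcons_path last_rcons => /andP[_ ez] -> _; exists (last x s).
Qed.

(** In an acyclic relation the number of nodes reachable from a node is a rank: the step to [y]
    loses at least [x]. *)
Lemma card_connect_lt (V : finType) (e : rel V) :
    (forall x y, e x y -> ~~ connect e y x) ->
  forall x y, e x y -> #|connect e y| < #|connect e x|.
Proof.
move=> acyc x y exy; apply: proper_card; apply/properP; split.
  by apply/subsetP=> z; apply: connect_trans; apply: connect1.
by exists x; [apply: connect0 | apply: acyc].
Qed.

Lemma count_sum_mem (V : finType) (a : pred V) (s : seq V) :
  count a s = \sum_(v | a v) count_mem v s.
Proof.
elim: s => [|x s IHs] /=; first by rewrite big1.
rewrite big_split /= -IHs; congr (_ + _); case ax: (a x).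
  by rewrite (bigD1 x) //= eqxx big1 // => v /andP[_ /negbTE]; rewrite eq_sym => ->.
by rewrite big1 // => v av; case: eqP => // xv; rewrite xv av in ax.
Qed.

(** * Firing sequences and the marking equation *)

Section Firing.
Variables (P T : finType) (pre : P -> T -> bool) (post : T -> P -> bool).
Implicit Types (m : marking P) (t u : T) (p : P) (s : seq T).

Lemma enabled_same_preset m t u :
  preT pre t = preT pre u -> enabled pre m t = enabled pre m u.
Proof.
by move/setP=> tu; apply: eq_forallb => p; move: (tu p); rewrite !inE => ->.
Qed.

Lemma fire_balance m t p :
  enabled pre m t -> fire pre post m t p + pre p t = m p + post t p.
Proof. by move/forallP/(_ p); rewrite ffunE; case: (pre p t) => /=; lia. Qed.

Lemma fires_balance s m m' p :
  fires pre post m s = Some m' ->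
  m' p + count (pre p) s = m p + count (post^~ p) s.
Proof.
elim: s m => [|t s IHs] m /=; first by case=> ->.
by case: ifP => // en /IHs; have := fire_balance p en; lia.
Qed.

Lemma fires_cat s1 s2 m :
  fires pre post m (s1 ++ s2) = obind (fun m' => fires pre post m' s2) (fires pre post m s1).
Proof. by elim: s1 m => //= t s1 IHs m; case: ifP. Qed.

Lemma reachable_trans m1 m2 m3 :
  reachable pre post m1 m2 -> reachable pre post m2 m3 -> reachable pre post m1 m3.
Proof. by case=> s1 f1 [s2 f2]; exists (s1 ++ s2); rewrite fires_cat f1. Qed.

Lemma reachable_fire m t : enabled pre m t -> reachable pre post m (fire pre post m t).
Proof. by move=> en; exists [:: t]; rewrite /= en. Qed.

Lemma fires_mem_enabled s m m' t :
  fires pre post m s = Some m' -> t \in s ->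
  exists2 m2, reachable pre post m m2 & enabled pre m2 t.
Proof.
elim: s m => // u s IHs m /=; case: ifP => // en fs.
rewrite inE => /predU1P[->|ts]; first by exists m => //; exists [::].
have [m2 r2 en2] := IHs _ fs ts; exists m2 => //.
exact: reachable_trans (reachable_fire en) r2.
Qed.

End Firing.

(** * A termination measure for acyclic nets *)

Section AcyclicNets.
Variables (P T : finType) (pre : P -> T -> bool) (post : T -> P -> bool).
Hypothesis acyc : acyclic pre post.

(* The base exceeds the number of output places of any transition, so that
   replacing one token by tokens on causally later places decreases the weight. *)
Definition weight (m : marking P) : nat :=
  \sum_p m p * #|P|.+1 ^ #|connect (flow pre post) (inl p)|.

Lemma weight_fire m t p0 :
  pre p0 t -> enabled pre m t -> weight (fire pre post m t) < weight m.
Proof.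
move=> pt en; pose w p := #|P|.+1 ^ #|connect (flow pre post) (inl p)|.
have eqW : weight (fire pre post m t) + \sum_p pre p t * w p
         = weight m + \sum_p post t p * w p.
  rewrite -!big_split /=; apply: eq_bigr => p _.
  by rewrite -!mulnDl fire_balance.
suff: \sum_p post t p * w p < \sum_p pre p t * w p by lia.
apply: (@leq_trans (w p0)); last by rewrite (bigD1 p0) //= pt mul1n leq_addr.
have lt_rank := card_connect_lt acyc.
have t_lt : #|connect (flow pre post) (inr t)| < #|connect (flow pre post) (inl p0)|.
  exact: lt_rank.
rewrite /w; case: #|connect _ (inl p0)| t_lt => // n le_n.
(* From [p0] exactly [n.+1] nodes are reachable, from an output place of [t] at most [n]; and [#|P|]
   summands [#|P|.+1 ^ n] stay below [#|P|.+1 ^ n.+1]. *)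
apply: (@leq_ltn_trans (\sum_(p : P) #|P|.+1 ^ n)).
  apply: leq_sum => p _; case tp: (post t p); rewrite ?mul0n // mul1n leq_pexp2l //.
  by rewrite -ltnS; apply: leq_trans le_n; apply/ltnW/lt_rank.
by rewrite sum_nat_const expnS ltn_pmul2r ?expn_gt0.
Qed.

Hypothesis pre_nonempty : forall t, exists p, pre p t.

Lemma weight_reachable m m' : reachable pre post m m' -> weight m' <= weight m.
Proof.
case=> s; elim: s m => [m [<-] // | t s IHs m /=]; case: ifP => // en /IHs le_m'.
have [p pt] := pre_nonempty t.
exact: leq_trans le_m' (ltnW (weight_fire pt en)).
Qed.

End AcyclicNets.

(** * Clusters of free choice nets *)

Section FreeChoiceNets.
Variables (P T : finType) (pre : P -> T -> bool) (post : T -> P -> bool).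
Hypothesis fc : free_choice pre.

(** Any other input place of [t] shares [t] with [p], so free choice gives it the postset of [p],
    which contains [u]. *)
Lemma free_choice_preset p t u : pre p t -> pre p u -> preT pre t = preT pre u.
Proof.
suff sub v w : pre p v -> pre p w -> preT pre v \subset preT pre w.
  by move=> pt pu; apply/eqP; rewrite eqEsubset !sub.
move=> pv pw; apply/subsetP=> q; rewrite !inE => qv.
by case: (fc p q) => [/setP/(_ v)|/setP/(_ w)]; rewrite !inE ?pv ?qv ?pw // => <-.
Qed.

Lemma connect_cluster_sym : connect_sym (cluster_step pre).
Proof. by apply: sym_connect_sym => -[p|t] [q|u]. Qed.

Lemma eq_clusterP x y :
  reflect (cluster pre x = cluster pre y) (connect (cluster_step pre) x y).
Proof.
apply: (iffP idP) => [xy|/setP/(_ y)]; last by rewrite !inE connect0 => ->.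
by apply/setP=> z; rewrite !inE; apply: same_connect; first exact: connect_cluster_sym.
Qed.

Lemma cluster_pre p t : pre p t -> cluster pre (inl p) = cluster pre (inr t).
Proof. by move=> pt; apply/eq_clusterP/connect1. Qed.

Lemma mem_cluster_transition u x :
  x \in cluster pre (inr u) ->
  match x return Prop with inl p => pre p u | inr v => preT pre v = preT pre u end.
Proof.
rewrite inE => /connectP[s]; elim/last_ind: s x => [|s y IHs] x; first by move=> _ ->.
rewrite rcons_path last_rcons => /andP[/IHs/(_ erefl)] IH stp ->.
move: IH stp; case: (last _ _) => [p|v]; case: y => [q|w] //= IH stp.
  exact: free_choice_preset stp IH.
by move/setP/(_ q): IH; rewrite !inE stp => /esym.
Qed.

Lemma dshortcut_applicableI o t u :
    (forall v, ~~ pre o v) -> preT pre t != preT pre u ->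
    (forall v, preT pre v = preT pre u -> v = u) ->
    preT pre u \subset postT post t ->
  dshortcut_applicable pre post o.
Proof.
move=> o_max neq_tu uniq_u sub_ut; exists t, (cluster pre (inr u)).
split; first exact: imset_f.
split.
  move=> p v /mem_cluster_transition pu /mem_cluster_transition/setP/(_ p).
  by rewrite !inE pu.
split.
  apply/eqP=> /setP/(_ (inl o)); rewrite [in RHS]inE connect0.
  by move/mem_cluster_transition; apply/negP.
split.
  apply: contra neq_tu => /eqP/setP/(_ (inr t)); rewrite [in RHS]inE connect0.
  by move/mem_cluster_transition/eqP.
split; last first.
  apply: subset_trans sub_ut; apply/subsetP=> p; rewrite inE => /mem_cluster_transition.
  by rewrite inE.
apply/eqP/cards1P; exists u; apply/setP=> v; rewrite !inE.
apply/idP/eqP => [uv|->]; last exact: connect0.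
by apply: uniq_u; apply: (@mem_cluster_transition u (inr v)); rewrite inE.
Qed.

(** * Causality between clusters *)

(** Immediate causality, made to depend on [u] only through its preset by letting [u'] range over
    all transitions in conflict with [u], and [u] itself. *)
Definition feeds : rel T := fun u v =>
  [exists u', (preT pre u' == preT pre u) && [exists q, post u' q && pre q v]].

Lemma feeds_post u q v : post u q -> pre q v -> feeds u v.
Proof.
by move=> uq qv; apply/existsP; exists u; rewrite eqxx; apply/existsP; exists q; rewrite uq.
Qed.

Lemma feeds_same_preset u u' v : preT pre u = preT pre u' -> feeds u v = feeds u' v.
Proof. by move=> uu'; rewrite /feeds uu'. Qed.

Hypothesis acyc : acyclic pre post.

(* A path of clusters lifts to a path of nodes ending in any prescribed
   transition of the last cluster, since the places of a cluster precede all of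
   its transitions. *)
Lemma feeds_acyclic u v : feeds u v -> ~~ connect feeds v u.
Proof.
have lift s a w' : path feeds a s -> preT pre w' = preT pre (last a s) ->
  exists2 a', preT pre a' = preT pre a & connect (flow pre post) (inr a') (inr w').
  elim: s a => [|b s IHs] a /=; first by exists w'.
  case/andP=> /existsP[a' /andP[/eqP aa' /existsP[q /andP[aq qb]]]] bs eq_w'.
  have [b' bb' cb'] := IHs _ bs eq_w'; exists a' => //.
  apply: connect_trans cb'; apply: (@connect_trans _ _ (inl q)); apply: connect1 => //=.
  by move/setP/(_ q): bb'; rewrite !inE qb.
case/existsP=> u' /andP[/eqP uu' /existsP[q /andP[uq qv]]].
apply/negP=> /connectP[s vs def_u]; rewrite def_u in uu'.
have [v' vv' cv'] := lift s v u' vs uu'.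
have qv' : pre q v' by move/setP/(_ q): vv'; rewrite !inE qv.
have/negP[] := acyc (x := inr u') (y := inl q) uq.
exact: connect_trans (connect1 (_ : flow pre post (inl q) (inr v'))) cv'.
Qed.

Lemma feeds_rank u v : feeds u v -> #|connect feeds v| < #|connect feeds u|.
Proof. exact/card_connect_lt/feeds_acyclic. Qed.

(** Strict causality: [connect] is reflexive, hence the explicit first step. *)
Definition after t u := [exists v, feeds t v && connect feeds v u].

Lemma after_feeds t u : feeds t u -> after t u.
Proof. by move=> tu; apply/existsP; exists u; rewrite tu connect0. Qed.

Lemma after_trans t u v : after t u -> feeds u v -> after t v.
Proof.
case/existsP=> w /andP[tw wu] uv; apply/existsP; exists w; rewrite tw.
exact: connect_trans wu (connect1 uv).
Qed.

Lemma after_preset t u : after t u -> preT pre t != preT pre u.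
Proof.
case/existsP=> v /andP[tv vu]; apply/eqP=> tu.
rewrite (feeds_same_preset _ tu) in tv.
by move/negP: (feeds_acyclic tv).
Qed.

Lemma after_rank t u : after t u -> #|connect feeds u| < #|connect feeds t|.
Proof.
case/existsP=> v /andP[/feeds_rank lt_vt vu]; apply: leq_ltn_trans lt_vt.
by apply/subset_leq_card/subsetP=> w; apply: connect_trans vu.
Qed.

(** * A causally last conflict *)

Section Conflict.
Variables (o : P) (t1 t2 : T).
Hypothesis o_max : forall v, ~~ pre o v.
Hypothesis eq_preset : preT pre t1 = preT pre t2.
Hypothesis pre_nonempty : forall t, exists p, pre p t.

(* [m0] bounds the places that can no longer receive tokens; a transition not
   after [t1] that is enabled later was therefore enabled at [m0] already. *)
Lemma fires_after m0 m s m' :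
    (forall u, enabled pre m0 u -> preT pre u = preT pre t1) ->
    (forall m2, reachable pre post m m2 -> ~~ enabled pre m2 t1) ->
    (forall v p, pre p v -> ~~ after t1 v -> m p <= m0 p) ->
  fires pre post m s = Some m' -> all (after t1) s.
Proof.
move=> quiet; elim: s m => //= u s IHs m never bnd; case: ifP => // en fs.
have au : after t1 u.
  apply: contraT => nau; have/negP[] := never m (ex_intro _ [::] erefl).
  rewrite -(enabled_same_preset m (quiet u _)) //; apply/forallP=> p; apply/implyP=> pu.
  by apply: leq_trans (bnd u p pu nau); move/forallP/(_ p): en; rewrite pu.
rewrite au; apply: IHs fs => [m2 r2|v p pv nav].
  exact: never (reachable_trans (reachable_fire post en) r2).
apply: leq_trans (bnd v p pv nav); have := fire_balance post p en.
case up: (post u p); last by lia.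
by rewrite (after_trans au (feeds_post up pv)) in nav.
Qed.

Lemma conflict_reduces m s1 s2 :
    t1 != t2 -> enabled pre m t1 ->
    (forall u v, after t1 u -> preT pre v = preT pre u -> v = u) ->
    all (after t1) s1 -> all (after t1) s2 ->
    fires pre post (fire pre post m t1) s1 = Some (mark1 o) ->
    fires pre post (fire pre post m t2) s2 = Some (mark1 o) ->
  merge_applicable pre post \/ dshortcut_applicable pre post o.
Proof.
move=> neq_t en1 uniq_after after1 after2 fires1 fires2.
have en2 : enabled pre m t2 by rewrite -(enabled_same_preset m eq_preset).
have same_pre p : pre p t1 = pre p t2 by move/setP/(_ p): eq_preset; rewrite !inE.
(* Marking equations of the two runs from [m] to [mark1 o]; the inputs of [t1] and [t2] cancel. *)
have balance p : count (pre p) s1 + post t2 p + count (post^~ p) s2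
               = count (pre p) s2 + post t1 p + count (post^~ p) s1.
  have := fire_balance post p en1; have := fire_balance post p en2.
  have := fires_balance p fires1; have := fires_balance p fires2.
  by rewrite same_pre; lia.
pose differ u := count_mem u s1 != count_mem u s2.
have [u0 du0|same] := pickP differ; last first.
  have eq_count a : count a s1 = count a s2.
    by rewrite !count_sum_mem; apply: eq_bigr => v _; apply/eqP/negbFE/same.
  left; exists t1, t2; do 2!split=> //; apply/setP=> p; rewrite !inE.
  by move: (balance p); rewrite !eq_count; case: (post t1 p); case: (post t2 p); lia.
(* Reachable sets shrink along [feeds], so a maximal one selects a causally first differing
   transition. *)
right; case: (arg_maxnP (fun u => #|connect feeds u|) du0) => u du max_u.
have au : after t1 u.
  apply: contraT => nau; move: du; rewrite /differ !(count_memPn _) ?eqxx //.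
    by apply: contra nau => /(allP after2).
  by apply: contra nau => /(allP after1).
have count_u p s : pre p u -> count (pre p) s = count_mem u s.
  move=> pu; apply: eq_count => v /=; apply/idP/eqP => [pv|-> //].
  exact: uniq_after au (free_choice_preset pv pu).
(* Transitions that fill an input place of [u] causally precede it, so they occur equally often in
   [s1] and [s2]. *)
have same_in p : pre p u -> count (post^~ p) s1 = count (post^~ p) s2.
  move=> pu; rewrite !count_sum_mem; apply: eq_bigr => v vp; apply/eqP; apply: contraT.
  by move/max_u/(leq_ltn_trans)/(_ (feeds_rank (feeds_post vp pu))); rewrite ltnn.
have diff p : pre p u -> count_mem u s1 + post t2 p = count_mem u s2 + post t1 p.
  by move=> pu; have := balance p; rewrite same_in // !count_u //; lia.
have neq_u := after_preset au.
(* By [diff], the one of [t1], [t2] whose completion contains [u] more often fills every input place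
   of [u]. *)
case: (ltngtP (count_mem u s1) (count_mem u s2)) => [lt_u|lt_u|eq_u].
- apply: (@dshortcut_applicableI o t2 u) => //; first by rewrite -eq_preset.
    by move=> v; apply: uniq_after.
  apply/subsetP=> p; rewrite !inE => /diff.
  by case: (post t2 p); case: (post t1 p); lia.
- apply: (@dshortcut_applicableI o t1 u) => //.
    by move=> v; apply: uniq_after.
  apply/subsetP=> p; rewrite !inE => /diff.
  by case: (post t2 p); case: (post t1 p); lia.
by rewrite /differ eq_u eqxx in du.
Qed.

(** Descent on [weight]: a later marking that enables [t1] is lighter and refuted by induction, so
    [t1] may be taken as never enabled again after a firing at [m]. *)
Lemma sound_no_last_conflict i :
    t1 != t2 -> sound pre post i o ->
    (forall u v, after t1 u -> preT pre v = preT pre u -> v = u) ->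
    ~ merge_applicable pre post -> ~ dshortcut_applicable pre post o -> False.
Proof.
move=> neq_t [to_final live] uniq_after no_merge no_short.
have [s [m' [/fires_mem_enabled fs /fs[m]]]] := live t1.
have [n] := ubnP (weight pre post m).
elim: n m {s fs m'} => // n IHn m; rewrite ltnS => le_m reach_m en1.
have fire_lt t : enabled pre m t -> weight pre post (fire pre post m t) < weight pre post m.
  by have [p pt] := pre_nonempty t; apply: weight_fire pt.
have never t m2 : enabled pre m t -> reachable pre post (fire pre post m t) m2 ->
    ~~ enabled pre m2 t1.
  move=> en r2; apply/negP; apply: IHn.
    apply: leq_trans le_m; apply: leq_ltn_trans (fire_lt t en).
    exact: weight_reachable r2.
  exact: reachable_trans reach_m (reachable_trans (reachable_fire post en) r2).
(* Otherwise, by free choice, [u] takes no token from the preset of [t1], and [t1] stays enabled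
   after [u] fires. *)
have quiet u : enabled pre m u -> preT pre u = preT pre t1.
  move=> en; apply/eqP; apply: contraT => neq_u.
  have/negP[] := never u _ en (ex_intro _ [::] erefl).
  apply/forallP=> p; apply/implyP=> pt.
  have := fire_balance post p en; have := forallP en1 p; rewrite pt /=.
  case pu: (pre p u); last by lia.
  by rewrite (free_choice_preset pu pt) eqxx in neq_u.
have completion t : preT pre t = preT pre t1 ->
    exists2 s, all (after t1) s & fires pre post (fire pre post m t) s = Some (mark1 o).
  move=> eq_t; have en : enabled pre m t by rewrite (enabled_same_preset m eq_t).
  have [s fs] := to_final _ (reachable_trans reach_m (reachable_fire post en)).
  exists s => //; apply: (fires_after quiet) fs => [m2|v p pv nav]; first exact: never en.
  (* Firing [t] adds tokens only on places whose consumers come after [t1]; [m] bounds the other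
     places. *)
  have := fire_balance post p en; case tp: (post t p); last by lia.
  case/negP: nav; apply: after_feeds.
  by rewrite -(feeds_same_preset _ eq_t); apply: feeds_post pv.
have [s1 all1 fires1] := completion t1 erefl.
have [s2 all2 fires2] := completion t2 (esym eq_preset).
by case: (conflict_reduces neq_t en1 uniq_after all1 all2 fires1 fires2).
Qed.

End Conflict.

(** * Conflict-free nets *)

(** Take a causally first [u] that does not consume from [i]. The transitions filling its input
    places precede it, hence consume from [i]; sharing a preset, they are all equal. *)
Lemma conflict_free_initial i o :
    (forall v, ~~ pre o v) ->
    (forall t, exists p, pre p t) ->
    (forall p, p != i -> exists t, post t p) ->
    (forall t u, preT pre t = preT pre u -> t = u) ->
    ~ dshortcut_applicable pre post o ->
  forall u, pre i u.
Proof.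
move=> o_max pre_nonempty post_nonempty conflict_free no_short u0.
apply: contraT => niu0; case: no_short.
case: (@arg_maxnP _ u0 (fun u => ~~ pre i u) (fun u => #|connect feeds u|) niu0) => u niu max_u.
have input p : pre p u -> exists2 t, post t p & pre i t.
  move=> pu; have [|t tp] := post_nonempty p.
    by apply: contraNneq niu => <-.
  exists t => //; apply: contraT => /max_u.
  by move/(leq_ltn_trans)/(_ (feeds_rank (feeds_post tp pu))); rewrite ltnn.
have [p0 /input[t0 _ it0]] := pre_nonempty u.
apply: (@dshortcut_applicableI o t0 u) => // [|v /conflict_free //|].
  by apply: contraNneq niu => /setP/(_ i); rewrite !inE it0.
apply/subsetP=> p; rewrite !inE => /input[t tp it].
by rewrite (conflict_free t0 t) // (free_choice_preset it0 it).
Qed.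

End FreeChoiceNets.

(** * Workflow nets to which neither rule applies *)

Theorem theoremA3 (P T : finType) (pre : P -> T -> bool) (post : T -> P -> bool)
  (i o : P) :
  is_workflow_net pre post i o ->
  sound pre post i o ->
  acyclic pre post ->
  free_choice pre ->
  ~ merge_applicable pre post ->
  ~ dshortcut_applicable pre post o ->
  clusters pre = [set cluster pre (inl i); cluster pre (inl o)] /\
  #|clusters pre| = 2.
Proof.
case=> neq_io [i_min [o_max strong]] snd acyc fc no_merge no_short.
have pre_nonempty t : exists p, pre p t.
  have [//|[p|u]] := connect_neq_pred (strong (inl i) (inr t)); last by [].
  by rewrite /flow_oi /= andbF orbF; exists p.
have post_nonempty p : p != i -> exists t, post t p.
  move=> neq_pi; have [] := connect_neq_pred (strong (inl i) (inl p)).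
    by rewrite eq_sym; apply: contra neq_pi => /eqP[->].
  by case=> [q|t]; rewrite /flow_oi /= ?orbF; [case/andP=> _ /eqP[def_p]; rewrite def_p eqxx in neq_pi | exists t].
have out_nonempty p : p != o -> exists t, pre p t.
  move=> neq_po; have [] := connect_neq_succ (strong (inl p) (inl o)).
    by apply: contra neq_po => /eqP[->].
  case=> [q|t]; rewrite /flow_oi /= ?andbF ?orbF; last by exists t.
  by case/andP=> /eqP[def_p]; rewrite def_p eqxx in neq_po.
have conflict_free t u : preT pre t = preT pre u -> t = u.
  move=> eq_tu; apply/eqP; apply: contraT => neq_tu.
  pose conflict v := [exists w, (v != w) && (preT pre v == preT pre w)].
  have conflict_t : conflict t by apply/existsP; exists u; rewrite neq_tu eq_tu /=.
  (* With fewest causal descendants chosen for [t1], every transition after [t1] has fewer and so is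
     in no conflict. *)
  case: (arg_minnP (fun v => #|connect (feeds pre post) v|) conflict_t) => t1.
  case/existsP=> t2 /andP[neq_t /eqP eq_t] min_t1.
  case: (@sound_no_last_conflict _ _ pre post fc acyc o t1 t2 o_max eq_t pre_nonempty i) => //.
  move=> v w av eq_wv; apply/eqP; apply: contraT => neq_wv.
  have /min_t1 : conflict v by apply/existsP; exists w; rewrite eq_sym neq_wv eq_wv /=.
  by rewrite leqNgt (after_rank acyc av).
have all_initial := conflict_free_initial fc acyc o_max pre_nonempty post_nonempty
                  conflict_free no_short.
have cluster_t t : cluster pre (inr t) = cluster pre (inl i) by rewrite (cluster_pre (all_initial t)).
have neq_clusters : cluster pre (inl i) != cluster pre (inl o).
  have [t it] := out_nonempty i neq_io.
  rewrite (cluster_pre it); apply/eqP=> /setP/(_ (inl o)); rewrite [in RHS]inE connect0.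
  by move/(mem_cluster_transition fc); apply/negP.
have def_clusters : clusters pre = [set cluster pre (inl i); cluster pre (inl o)].
  (* Every place other than [o] has an output transition, and all transitions lie in the cluster of
     [i]. *)
  apply/setP=> c; rewrite !inE; apply/imsetP/orP => [[[p|t] _ ->]|[]/eqP->].
  - have [->|/out_nonempty[t pt]] := eqVneq p o; first by right.
    by left; rewrite (cluster_pre pt) cluster_t.
  - by left; rewrite cluster_t.
  - by exists (inl i).
  - by exists (inl o).
by rewrite def_clusters cards2 neq_clusters.
Qed.
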